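(* Let $G=\langle G,\cdot,1\rangle$ be a definable group with $G\subseteq M^n$ and $\dim G=k$. Suppose that (i) $X\subseteq M^m$ and $Z\subseteq X^2$ are two $\mathcal L$-definable sets with $\dim(X^2\setminus Z)<2k$; (ii) $h:X\to G$ is a definable injective map with $\dim(G\setminus h(X))<k$; (iii) $F:X^2\to X$ is an $\mathcal L$-definable map such that for every $(x,y)\in Z$, $h(x)\cdot h(y)=h(F(x,y))$. Then $G$ is definably isomorphic to an $\mathcal L$-interpretable group. If, moreover, $\mathcal M$ is o-minimal, then $G$ is definably isomorphic to an $\mathcal L$-definable group.
   Context: Let $\mathcal M$ and $\mathcal N$ be arbitrary first-order structures, with $\mathcal N$ expanding $\mathcal M$; $\mathcal L$ is the language of $\mathcal M$. ''$\mathcal L$-definable'' means definable in $\mathcal M$ with parameters; ''definable'' means definable in $\mathcal N$ with parameters. ($\mathcal M$ is not assumed o-minimal.) Assume there is a map $\dim$ from the class of all definable sets to $\{-\infty\}\cup\mathbb N$ such that for all definable $X,Y\subseteq M^n$ and $a\in M$: (D1) $\dim\{a\}=1$ [as stated in the paper], $\dim M=1$, and $\dim X=-\infty$ iff $X=\emptyset$; (D2) $\dim(X\cup Y)=\max\{\dim X,\dim Y\}$; (D3b) if $\{X_t\}_{t\in I}$ is a disjoint definable family of sets each of dimension $k$, then $\dim\bigcup_{t\in I}X_t=\dim I+k$; (D4) if $f:X\to Y$ is a definable bijection then $\dim X=\dim Y$; (Ldef) if $\{X_t\}_{t\in I}$ is an $\mathcal L$-definable disjoint family, then for each $d$ the set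 $I_d=\{t\in I:\dim X_t=d\}$ is $\mathcal L$-definable. A definable quotient is $X/E$ for a definable set $X$ and a definable equivalence relation $E$; a map $f:X/E_1\to Y/E_2$ is definable if $\{(x,y)\in X\times Y: f([x])=[y]\}$ is definable; an interpretable group is a group whose universe is a definable quotient and whose operation is a definable map. ''$\mathcal L$-interpretable''/''$\mathcal L$-definable'' refer to these notions in $\mathcal M$, and ''definably isomorphic'' means via a map definable in $\mathcal N$.
   Formalization: Axiom (D1) is taken with dim{a} = 0 instead of the printed dim{a} = 1, since the printed value contradicts (D3b) and dim M = 1 (M is the disjoint union of its points, giving dim M = dim M + 1). *)

(* Defs.v *)
From mathcomp Require Import all_boot.
From Stdlib Require List.

Set Implicit Arguments.
Unset Strict Implicit.
Unset Printing Implicit Defensive.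

Record signature := Signature {
  fsym : Type; fari : fsym -> nat;
  rsym : Type; rari : rsym -> nat }.

Record structure (S : signature) (M : Type) := Structure {
  sfun : forall f : fsym S, ('I_(fari f) -> M) -> M;
  srel : forall r : rsym S, ('I_(rari r) -> M) -> Prop }.

Inductive term (S : signature) :=
  | Var : nat -> term S
  | Fn : forall f : fsym S, ('I_(fari f) -> term S) -> term S.

Inductive formula (S : signature) :=
  | FEq : term S -> term S -> formula S
  | FRel : forall r : rsym S, ('I_(rari r) -> term S) -> formula S
  | FNot : formula S -> formula S
  | FAnd : formula S -> formula S -> formula S
  | FEx : nat -> formula S -> formula S.   (* FEx i phi : exists v_i, phi *)

Section Semantics.
Variables (S : signature) (M : Type) (St : structure S M).

Fixpoint eval (e : nat -> M) (t : term S) : M :=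
  match t with
  | Var i => e i
  | Fn f ts => @sfun S M St f (fun j => eval e (ts j))
  end.

Definition upd (e : nat -> M) (i : nat) (a : M) : nat -> M :=
  fun j => if j == i then a else e j.

Fixpoint sat (e : nat -> M) (phi : formula S) : Prop :=
  match phi with
  | FEq t u => eval e t = eval e u
  | FRel r ts => @srel S M St r (fun j => eval e (ts j))
  | FNot p => ~ sat e p
  | FAnd p q => sat e p /\ sat e q
  | FEx i p => exists a : M, sat (upd e i a) p
  end.

(** environment: variables 0..n-1 are the tuple x, the others are parameters *)
Definition env_of (n : nat) (x : 'I_n -> M) (par : nat -> M) : nat -> M :=
  fun i => match (insub i : option 'I_n) with Some j => x j | None => par i end.

Definition definable (n : nat) (X : ('I_n -> M) -> Prop) : Prop :=
  exists (phi : formula S) (par : nat -> M),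
    forall x : 'I_n -> M, X x <-> sat (env_of x par) phi.

End Semantics.

(** expansion N of M: language of N = L + extra symbols E *)
Definition sig_sum (L E : signature) : signature :=
  {| fsym := (fsym L + fsym E)%type;
     fari := fun f => match f with inl a => fari a | inr b => fari b end;
     rsym := (rsym L + rsym E)%type;
     rari := fun r => match r with inl a => rari a | inr b => rari b end |}.

Definition expand (L E : signature) (M : Type) (SM : structure L M)
  (SE : structure E M) : structure (sig_sum L E) M :=
  {| sfun := fun f => match f as f0 return ('I_(@fari (sig_sum L E) f0) -> M) -> M with
                      | inl a => @sfun L M SM a | inr b => @sfun E M SE b end;
     srel := fun r => match r as r0 return ('I_(@rari (sig_sum L E) r0) -> M) -> Prop with
                      | inl a => @srel L M SM a | inr b => @srel E M SE b end |}.

Definition tcat (M : Type) (p n : nat) (t : 'I_p -> M) (x : 'I_n -> M) : 'I_(p + n) -> M :=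
  fun i => match split i with inl j => t j | inr j => x j end.
Definition lpart (M : Type) (p n : nat) (z : 'I_(p + n) -> M) : 'I_p -> M :=
  fun j => z (lshift n j).
Definition rpart (M : Type) (p n : nat) (z : 'I_(p + n) -> M) : 'I_n -> M :=
  fun j => z (rshift p j).

Definition sqset (M : Type) (m : nat) (X : ('I_m -> M) -> Prop) : ('I_(m + m) -> M) -> Prop :=
  fun z => X (lpart z) /\ X (rpart z).

Definition fiber (M : Type) (p n : nat) (D : ('I_(p + n) -> M) -> Prop) (t : 'I_p -> M)
  : ('I_n -> M) -> Prop := fun x => D (tcat t x).

Definition disjoint_family (M : Type) (p n : nat) (I : ('I_p -> M) -> Prop)
  (D : ('I_(p + n) -> M) -> Prop) : Prop :=
  forall t t' x, I t -> I t' -> t <> t' -> fiber D t x -> fiber D t' x -> False.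

Definition def_map (S : signature) (M : Type) (St : structure S M) (n m : nat)
  (X : ('I_n -> M) -> Prop) (Y : ('I_m -> M) -> Prop) (f : ('I_n -> M) -> ('I_m -> M)) : Prop :=
  (forall x, X x -> Y (f x)) /\
  definable St (fun z : 'I_(n + m) -> M => X (lpart z) /\ rpart z = f (lpart z)).

Definition bij_on (M : Type) (n m : nat) (X : ('I_n -> M) -> Prop) (Y : ('I_m -> M) -> Prop)
  (f : ('I_n -> M) -> ('I_m -> M)) : Prop :=
  (forall x, X x -> Y (f x)) /\
  (forall x x', X x -> X x' -> f x = f x' -> x = x') /\
  (forall y, Y y -> exists x, X x /\ f x = y).

(** * Dimension values: None = -oo *)
Definition dimv := option nat.
Definition dmax (a b : dimv) : dimv :=
  match a, b with
  | None, _ => b | _, None => a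
  | Some x, Some y => Some (maxn x y) end.
Definition dlt (d : dimv) (k : nat) : Prop :=
  match d with None => True | Some x => (x < k)%N end.

Definition dimfun (M : Type) := forall n : nat, (('I_n -> M) -> Prop) -> dimv.

Section DimAxioms.
Variables (L E : signature) (M : Type) (SM : structure L M) (SE : structure E M).
Variable dim : dimfun M.
Local Notation defN := (definable (expand SM SE)).
Local Notation defL := (definable SM).

Record dim_axioms : Prop := {
  dim_point : forall a : M, dim (fun x : 'I_1 -> M => x = (fun _ => a)) = Some 0;
  dim_line : dim (fun _ : 'I_1 -> M => True) = Some 1;
  dim_empty : forall n (X : ('I_n -> M) -> Prop), defN X ->
      (dim X = None <-> forall x, ~ X x);
  dim_union : forall n (X Y : ('I_n -> M) -> Prop), defN X -> defN Y ->
      dim (fun x => X x \/ Y x) = dmax (dim X) (dim Y);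
  dim_family : forall p n (I : ('I_p -> M) -> Prop) (D : ('I_(p + n) -> M) -> Prop) (k : nat),
      defN I -> defN D -> disjoint_family I D ->
      (forall t, I t -> dim (fiber D t) = Some k) ->
      dim (fun x : 'I_n -> M => exists t, I t /\ fiber D t x) = omap (addn k) (dim I);
  dim_bij : forall n m (X : ('I_n -> M) -> Prop) (Y : ('I_m -> M) -> Prop) f,
      defN X -> defN Y -> def_map (expand SM SE) X Y f -> bij_on X Y f ->
      dim X = dim Y;
  dim_Ldef : forall p n (I : ('I_p -> M) -> Prop) (D : ('I_(p + n) -> M) -> Prop) (d : dimv),
      defL I -> defL D -> disjoint_family I D ->
      defL (fun t => I t /\ dim (fiber D t) = d)
}.
End DimAxioms.

Definition is_group (T : Type) (G : T -> Prop) (mul : T -> T -> T) (one : T) : Prop :=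
  G one /\
  (forall x y, G x -> G y -> G (mul x y)) /\
  (forall x y z, G x -> G y -> G z -> mul (mul x y) z = mul x (mul y z)) /\
  (forall x, G x -> mul one x = x /\ mul x one = x) /\
  (forall x, G x -> exists y, G y /\ mul x y = one /\ mul y x = one).

Definition op_graph (M : Type) (n : nat) (G : ('I_n -> M) -> Prop)
  (mul : ('I_n -> M) -> ('I_n -> M) -> ('I_n -> M)) : ('I_(n + n + n) -> M) -> Prop :=
  fun z => G (lpart (lpart z)) /\ G (rpart (lpart z)) /\
           rpart z = mul (lpart (lpart z)) (rpart (lpart z)).

Definition definable_group (S : signature) (M : Type) (St : structure S M) (n : nat)
  (G : ('I_n -> M) -> Prop) (mul : ('I_n -> M) -> ('I_n -> M) -> ('I_n -> M))
  (one : 'I_n -> M) : Prop :=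
  definable St G /\ definable St (op_graph G mul) /\ is_group G mul one.

Definition cls (M : Type) (p : nat) (Y : ('I_p -> M) -> Prop) (E : ('I_(p + p) -> M) -> Prop)
  (y : 'I_p -> M) : ('I_p -> M) -> Prop := fun z => Y z /\ E (tcat y z).

Definition equiv_on (M : Type) (p : nat) (Y : ('I_p -> M) -> Prop)
  (E : ('I_(p + p) -> M) -> Prop) : Prop :=
  (forall y z, E (tcat y z) -> Y y /\ Y z) /\
  (forall y, Y y -> E (tcat y y)) /\
  (forall y z, E (tcat y z) -> E (tcat z y)) /\
  (forall x y z, E (tcat x y) -> E (tcat y z) -> E (tcat x z)).

Definition quot (M : Type) (p : nat) (Y : ('I_p -> M) -> Prop)
  (E : ('I_(p + p) -> M) -> Prop) : Type :=
  { C : ('I_p -> M) -> Prop | exists y, Y y /\ C = cls Y E y }.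

Definition iso_to_L_interpretable (L E : signature) (M : Type) (SM : structure L M)
  (SE : structure E M) (n : nat) (G : ('I_n -> M) -> Prop)
  (mul : ('I_n -> M) -> ('I_n -> M) -> ('I_n -> M)) : Prop :=
  exists (p : nat) (Y : ('I_p -> M) -> Prop) (Eq : ('I_(p + p) -> M) -> Prop),
    definable SM Y /\ definable SM Eq /\ equiv_on Y Eq /\
    exists (qmul : quot Y Eq -> quot Y Eq -> quot Y Eq) (qone : quot Y Eq),
      is_group (fun _ => True) qmul qone /\
      definable SM (fun z : 'I_(p + p + p) -> M =>
          let a := lpart (lpart z) in let b := rpart (lpart z) in let c := rpart z in
          Y a /\ Y b /\ Y c /\
          exists A B : quot Y Eq, proj1_sig A = cls Y Eq a /\ proj1_sig B = cls Y Eq b /\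
                                  proj1_sig (qmul A B) = cls Y Eq c) /\
      exists phi : ('I_n -> M) -> quot Y Eq,
        (forall x x', G x -> G x' -> phi x = phi x' -> x = x') /\
        (forall Q : quot Y Eq, exists x, G x /\ phi x = Q) /\
        (forall x y, G x -> G y -> phi (mul x y) = qmul (phi x) (phi y)) /\
        definable (expand SM SE) (fun z : 'I_(n + p) -> M =>
          G (lpart z) /\ Y (rpart z) /\ proj1_sig (phi (lpart z)) = cls Y Eq (rpart z)).

Definition iso_to_L_definable (L E : signature) (M : Type) (SM : structure L M)
  (SE : structure E M) (n : nat) (G : ('I_n -> M) -> Prop)
  (mul : ('I_n -> M) -> ('I_n -> M) -> ('I_n -> M)) : Prop :=
  exists (p : nat) (H : ('I_p -> M) -> Prop) (hmul : ('I_p -> M) -> ('I_p -> M) -> ('I_p -> M))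
         (hone : 'I_p -> M),
    definable_group SM H hmul hone /\
    exists psi : ('I_n -> M) -> ('I_p -> M),
      def_map (expand SM SE) G H psi /\ bij_on G H psi /\
      (forall x y, G x -> G y -> psi (mul x y) = hmul (psi x) (psi y)).

Definition o_minimal (L : signature) (M : Type) (SM : structure L M) : Prop :=
  exists r : rsym L, rari r = 2 /\
  let lt := fun a b : M => exists v : 'I_(rari r) -> M,
      @srel L M SM r v /\ forall i : 'I_(rari r), v i = if nat_of_ord i == 0 then a else b in
  (forall a, ~ lt a a) /\
  (forall a b c, lt a b -> lt b c -> lt a c) /\
  (forall a b, lt a b \/ a = b \/ lt b a) /\
  (forall a b, lt a b -> exists c, lt a c /\ lt c b) /\
  (forall a, exists b c, lt b a /\ lt a c) /\
  (forall X : ('I_1 -> M) -> Prop, definable SM X ->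
     exists (pts : list M) (ivs : list (option M * option M)),
       forall x : M, X (fun _ => x) <->
         (List.In x pts \/
          exists iv, List.In iv ivs /\
            (match iv.1 with None => True | Some a => lt a x end) /\
            (match iv.2 with None => True | Some b => lt x b end))).

(* Main.v *)
Require Import Defs.
From mathcomp Require Import all_boot.
From Stdlib Require Import Classical ClassicalEpsilon FunctionalExtensionality
  PropExtensionality ProofIrrelevance.

(* Discard from [X] the points [x] for which [(z, x)] is outside [Z] for a set of [z] of full
   dimension [k]; call the others good. Two products [h x_1 * ... * h x_r] of good points
   agree iff, for some [z] in [X], iterating [F] from [z] along both words stays in [Z] and
   ends at the same point: generic [z] allow the iteration, and then cancel. So equality of
   such products is L-definable. The image [V] of the good points is large in [G]; if [S] is
   a definable subset of [G], some [g] in [V] satisfies [dim (S \ gV) < dim S], whence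
   finitely many translates [h a_i * V] cover [G]. Keeping for each element of [G] the first
   translate containing it gives an L-definable set of pairs [(a_i, x)] in bijection with
   [G], carrying an L-definable multiplication. Hence [G] is isomorphic to an L-definable
   group, and an L-definable group is the L-interpretable one with equality as relation. *)

Set Implicit Arguments.
Unset Strict Implicit.
Unset Printing Implicit Defensive.

Lemma fun_choice (A B : Type) (R : A -> B -> Prop) :
  (forall x, exists y, R x y) -> exists f : A -> B, forall x, R x (f x).
Proof.
move=> H; exists (fun x => proj1_sig (constructive_indefinite_description _ (H x))) => x.
exact: proj2_sig.
Qed.

Lemma pred_ext (T : Type) (P Q : T -> Prop) : (forall x, P x <-> Q x) -> P = Q.
Proof. by move=> H; apply: functional_extensionality => x; apply: propositional_extensionality. Qed.

(** * Tuples *)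

Section Tuples.
Variable M : Type.

Lemma lpart_tcat p n (t : 'I_p -> M) (x : 'I_n -> M) : lpart (tcat t x) = t.
Proof.
by apply: functional_extensionality => i; rewrite /lpart /tcat (unsplitK (inl i)).
Qed.

Lemma rpart_tcat p n (t : 'I_p -> M) (x : 'I_n -> M) : rpart (tcat t x) = x.
Proof.
by apply: functional_extensionality => i; rewrite /rpart /tcat (unsplitK (inr i)).
Qed.

Lemma tcat_parts p n (z : 'I_(p + n) -> M) : tcat (lpart z) (rpart z) = z.
Proof.
apply: functional_extensionality => i; rewrite /tcat /lpart /rpart.
by rewrite -[RHS](congr1 z (splitK i)); case: (split i).
Qed.

End Tuples.

(** * Closure properties of definable sets *)

Section Definability.
Variables (S : signature) (M : Type) (St : structure S M).
Implicit Types (e par : nat -> M) (phi : formula S).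

(** * Variables and renaming in formulas *)

Fixpoint tbound (t : term S) : nat :=
  match t with
  | Var i => i.+1
  | Fn f ts => \max_(j < fari f) tbound (ts j)
  end.

(** Bound occurrences are counted too; any upper bound on the free variables suffices for picking a
    fresh one. *)
Fixpoint fbound phi : nat :=
  match phi with
  | FEq t u => maxn (tbound t) (tbound u)
  | FRel r ts => \max_(j < rari r) tbound (ts j)
  | FNot p => fbound p
  | FAnd p q => maxn (fbound p) (fbound q)
  | FEx i p => fbound p
  end.

Lemma eval_agree t e e' :
  (forall i, i < tbound t -> e i = e' i) -> eval St e t = eval St e' t.
Proof.
elim: t => [i|f ts IH] /= H; first exact: H.
congr (sfun _); apply: functional_extensionality => j; apply: IH => i lti.
by apply: H; apply: leq_trans lti _; exact: (leq_bigmax (F := fun j => tbound (ts j))).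
Qed.

Lemma sat_agree phi e e' :
  (forall i, i < fbound phi -> e i = e' i) -> sat St e phi <-> sat St e' phi.
Proof.
elim: phi e e' => [t u|r ts|p IH|p IHp q IHq|i p IH] e e' /= H.
- rewrite (@eval_agree t e e') ?(@eval_agree u e e') // => i lti; apply: H;
  by rewrite leq_max lti ?orbT.
- suff -> : (fun j => eval St e (ts j)) = (fun j => eval St e' (ts j)) by [].
  apply: functional_extensionality => j; apply: eval_agree => i lti.
  by apply: H; apply: leq_trans lti _; exact: (leq_bigmax (F := fun j => tbound (ts j))).
- by rewrite (IH e e').
- by rewrite (IHp e e') ?(IHq e e') // => i lti; apply: H; rewrite leq_max lti ?orbT.
- have E a : sat St (upd e i a) p <-> sat St (upd e' i a) p.
    by apply: IH => j ltj; rewrite /upd; case: eqP => // _; apply: H.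
  by split=> -[a Ha]; exists a; apply/E.
Qed.

Fixpoint trename (r : nat -> nat) (t : term S) : term S :=
  match t with
  | Var i => Var S (r i)
  | Fn f ts => Fn (fun j => trename r (ts j))
  end.

Lemma eval_trename r t e : eval St e (trename r t) = eval St (fun i => e (r i)) t.
Proof.
elim: t => //= f ts IH; congr (sfun _).
exact: functional_extensionality.
Qed.

(** The map [r] may fail to be injective and changes under a quantifier, so the induction keeps it
    general. *)
Lemma rename_formula phi (r : nat -> nat) :
  exists psi, forall e, sat St e psi <-> sat St (fun i => e (r i)) phi.
Proof.
elim: phi r => [t u|s ts|p IH|p IHp q IHq|i p IH] r.
- by exists (FEq (trename r t) (trename r u)) => e /=; rewrite !eval_trename.
- exists (FRel (fun j => trename r (ts j))) => e /=.
  suff -> : (fun j => eval St e (trename r (ts j))) =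
            (fun j => eval St (fun i => e (r i)) (ts j)) by [].
  by apply: functional_extensionality => j; rewrite eval_trename.
- by have [p' Hp] := IH r; exists (FNot p') => e /=; rewrite Hp.
- have [p' Hp] := IHp r; have [q' Hq] := IHq r.
  by exists (FAnd p' q') => e /=; rewrite Hp Hq.
- (* The bound variable is renamed to one above every renamed free variable. *)
  pose j := \max_(x < fbound p) (r x).+1.
  have [p' Hp] := IH (fun x => if x == i then j else r x).
  exists (FEx j p') => e /=.
  have E a : sat St (upd e j a) p' <-> sat St (upd (fun i => e (r i)) i a) p.
    rewrite Hp; apply: sat_agree => x ltx; rewrite /upd.
    case: (x == i); first by rewrite eqxx.
    have ltr : r x < j.
      exact: (leq_bigmax (F := fun x : 'I_(fbound p) => (r x).+1) (Ordinal ltx)).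
    by rewrite (ltn_eqF ltr).
  by split=> -[a Ha]; exists a; apply/E.
Qed.

(** * Definable conditions on environments *)

Definition interleave e par : nat -> M :=
  fun i => if odd i then par i./2 else e i./2.

Lemma interleave_even e par i : interleave e par i.*2 = e i.
Proof. by rewrite /interleave odd_double doubleK. Qed.

Lemma interleave_odd e par i : interleave e par i.*2.+1 = par i.
Proof. by rewrite /interleave /= odd_double /= uphalf_double. Qed.

(* Even variables carry the environment and odd ones the parameters, so that the
   parameters of two formulas can be merged by renaming. *)
Definition edef (A : (nat -> M) -> Prop) : Prop :=
  exists phi par, forall e, A e <-> sat St (interleave e par) phi.

Lemma edef_ext (A B : (nat -> M) -> Prop) :
  (forall e, A e <-> B e) -> edef A -> edef B.
Proof. by move=> /pred_ext ->. Qed.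

Lemma edef_rename A (r : nat -> nat) : edef A -> edef (fun e => A (fun i => e (r i))).
Proof.
move=> [phi [par H]].
have [psi Hpsi] := rename_formula phi (fun i => if odd i then i else (r i./2).*2).
exists psi, par => e; rewrite H Hpsi.
suff -> : interleave (fun i => e (r i)) par =
  (fun i => interleave e par (if odd i then i else (r i./2).*2)) by [].
apply: functional_extensionality => i; case: ifP => oi.
  by rewrite /interleave oi.
by rewrite interleave_even /interleave oi.
Qed.

Lemma edef_not A : edef A -> edef (fun e => ~ A e).
Proof. by move=> [phi [par H]]; exists (FNot phi), par => e; rewrite H. Qed.

Lemma edef_and A B : edef A -> edef B -> edef (fun e => A e /\ B e).
Proof.
move=> [phi [par H]] [psi [par' H']].
(* In the merged parameter list, the parameters of [phi] take the even places and those of [psi] the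
   odd ones; environment variables stay put. *)
have [phi1 H1] := rename_formula phi (fun i => if odd i then (i./2.*2).*2.+1 else i).
have [psi1 H1'] := rename_formula psi (fun i => if odd i then (i./2.*2.+1).*2.+1 else i).
exists (FAnd phi1 psi1), (interleave par par') => e /=; rewrite H H' H1 H1'.
suff [-> ->] : interleave e par = (fun i => interleave e (interleave par par')
    (if odd i then (i./2.*2).*2.+1 else i)) /\
  interleave e par' = (fun i => interleave e (interleave par par')
    (if odd i then (i./2.*2.+1).*2.+1 else i)) by [].
split; apply: functional_extensionality => i; case: ifP => oi;
  by rewrite ?interleave_odd ?interleave_even /interleave oi.
Qed.

Lemma edef_or A B : edef A -> edef B -> edef (fun e => A e \/ B e).
Proof.
move=> dA dB; apply: (@edef_ext (fun e => ~ (~ A e /\ ~ B e))).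
  by move=> e; split; [move=> ?; apply: NNPP|]; tauto.
by apply: edef_not; apply: edef_and; apply: edef_not.
Qed.

Lemma edef_ex1 A j : edef A -> edef (fun e => exists a, A (upd e j a)).
Proof.
move=> [phi [par H]]; exists (FEx j.*2 phi), par => e /=.
have E a : A (upd e j a) <-> sat St (upd (interleave e par) j.*2 a) phi.
  rewrite H; suff -> : interleave (upd e j a) par = upd (interleave e par) j.*2 a by [].
  apply: functional_extensionality => i; rewrite /upd /interleave.
  case oi: (odd i).
    by case: eqP oi => // ->; rewrite odd_double.
  have Ei : i./2.*2 = i by rewrite -[RHS]odd_double_half oi.
  by rewrite -[in RHS]Ei (inj_eq double_inj) Ei.
by split=> -[a Ha]; exists a; apply/E.
Qed.

Lemma edef_ex_agree n A : edef A ->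
  edef (fun e => exists e', (forall i, n <= i -> e' i = e i) /\ A e').
Proof.
move=> dA; elim: n => [|n IH].
  apply: edef_ext dA => e; split=> [Ae|[e' [He' Ae']]]; first by exists e.
  by have <- : e' = e by apply: functional_extensionality => i; apply: He'.
apply: edef_ext (edef_ex1 n IH) => e; split=> [[a [e' [He' Ae']]]|[e' [He' Ae']]].
  exists e'; split=> // i lti; rewrite He' ?(ltnW lti) // /upd.
  by rewrite (gtn_eqF lti).
exists (e' n), e'; split=> // i lei; rewrite /upd; case: eqVneq => [->|ni] //.
by apply: He'; rewrite ltn_neqAle eq_sym ni.
Qed.

(** De Bruijn style: the quantified tuple occupies the first [n] variables and the outer environment
    is shifted by [n]. *)
Lemma edef_ex n (A : (nat -> M) -> ('I_n -> M) -> Prop) :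
  edef (fun e => A (fun i => e (n + i)) (fun i => e i)) ->
  edef (fun e => exists x, A e x).
Proof.
(* The subtraction undoes the shift. It truncates below [n], where the values are overwritten by the
   quantified ones. *)
move=> /(@edef_ex_agree n) /(edef_rename (fun i => i - n)); apply: edef_ext => e.
split=> [[e' [He' Ae']]|[x Ax]].
  exists (fun i => e' i); have <- // : (fun i => e' (n + i)) = e.
  by apply: functional_extensionality => i; rewrite He' ?leq_addr // addKn.
exists (fun i => if insub i is Some j then x j else e (i - n)); split=> [i lei|].
  by case: insubP => //= j; rewrite ltnNge lei.
suff [-> ->] : (fun i => if insub (n + i) is Some j then x j else e (n + i - n)) = e /\
   (fun i : 'I_n => if insub (nat_of_ord i) is Some j then x j else e (i - n)) = x by [].
split; apply: functional_extensionality => i.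
  by case: insubP => [j|_]; [rewrite ltnNge leq_addr | rewrite addKn].
by rewrite valK.
Qed.

(** Every coordinate is a variable or a constant. Such tuples are closed under concatenation,
    projection and renaming, so definability can be read off the shape of a condition. *)
Definition tuple_term n (t : (nat -> M) -> 'I_n -> M) : Prop :=
  forall i, (exists r, forall e, t e i = e r) \/ (exists c, forall e, t e i = c).

Lemma tterm_var n (r : 'I_n -> nat) : tuple_term (fun e i => e (r i)).
Proof. by move=> i; left; exists (r i). Qed.

Lemma tterm_const n (a : 'I_n -> M) : tuple_term (fun _ => a).
Proof. by move=> i; right; exists (a i). Qed.

Lemma tterm_tcat p n (t : (nat -> M) -> 'I_p -> M) (s : (nat -> M) -> 'I_n -> M) :
  tuple_term t -> tuple_term s -> tuple_term (fun e => tcat (t e) (s e)).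
Proof. by move=> Ht Hs i; rewrite /tcat; case: (split i) => j. Qed.

Lemma tterm_lpart p n (t : (nat -> M) -> 'I_(p + n) -> M) :
  tuple_term t -> tuple_term (fun e => lpart (t e)).
Proof. by move=> Ht i; apply: Ht. Qed.

Lemma tterm_rpart p n (t : (nat -> M) -> 'I_(p + n) -> M) :
  tuple_term t -> tuple_term (fun e => rpart (t e)).
Proof. by move=> Ht i; apply: Ht. Qed.

Lemma tterm_rename (r : nat -> nat) n (t : (nat -> M) -> 'I_n -> M) :
  tuple_term t -> tuple_term (fun e => t (fun i => e (r i))).
Proof.
move=> Ht i; case: (Ht i) => -[j Hj]; [left; exists (r j)|right; exists j] => e;
  by rewrite Hj.
Qed.

Lemma edef_mem n (X : ('I_n -> M) -> Prop) t :
  definable St X -> tuple_term t -> edef (fun e => X (t e)).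
Proof.
move=> [phi [par H]] Ht.
(* A variable of [phi] reads either an environment variable or a constant; constants, the old
   parameters among them, are stored as parameter number [i]. *)
have /fun_choice [s Hs] : forall i, exists s : nat + M, forall e,
    env_of (t e) par i = match s with inl r => e r | inr c => c end.
  move=> i; rewrite /env_of; case: insubP => [j _ _|_]; last by exists (inr (par i)).
  by case: (Ht j) => -[r Hr]; [exists (inl r)|exists (inr r)].
have [psi Hpsi] := rename_formula phi
  (fun i => match s i with inl r => r.*2 | inr c => i.*2.+1 end).
exists psi, (fun i => match s i with inl r => par i | inr c => c end) => e.
rewrite Hpsi H; match goal with |- sat _ ?a _ <-> sat _ ?b _ => suff -> : a = b by [] end.
apply: functional_extensionality => i; rewrite Hs.
by case E: (s i) => [r|c]; rewrite ?interleave_even ?interleave_odd ?E.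
Qed.

Lemma edef_definable n (X : ('I_n -> M) -> Prop) :
  edef (fun e => X (fun i => e i)) -> definable St X.
Proof.
move=> [phi [par H]].
(* Only the first [n] environment variables are kept; the old parameters and the remaining
   environment variables are moved past the tuple and read as parameters. *)
have [psi Hpsi] := rename_formula phi
  (fun i => if odd i || (n <= i./2) then n + i else i./2).
exists psi, (fun i => interleave par par (i - n)) => x.
pose e i := if insub i is Some j then x j else par i.
have -> : x = (fun i => e i).
  by apply: functional_extensionality => i; rewrite /e valK.
rewrite H Hpsi; match goal with |- sat _ ?a _ <-> sat _ ?b _ => suff -> : a = b by [] end.
apply: functional_extensionality => i; rewrite {1}/interleave /env_of.
case oi: (odd i) => /=.
  by case: insubP => [j|_]; [rewrite ltnNge leq_addr|rewrite addKn /interleave oi].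
case: leqP => lei.
  rewrite /e; case: insubP => [j|_]; first by rewrite ltnNge lei.
  by case: insubP => [j|_]; [rewrite ltnNge leq_addr|rewrite addKn /interleave oi].
by rewrite insubT /e insubT.
Qed.

Lemma edef_eq1 (i j : nat) (c : M) : edef (fun e => e i = e j).
Proof.
exists (FEq (Var S i.*2) (Var S j.*2)), (fun _ => c) => e.
by rewrite /= !interleave_even.
Qed.

Lemma edef_forall_ord n (A : 'I_n -> (nat -> M) -> Prop) (c : M) :
  (forall i, edef (A i)) -> edef (fun e => forall i, A i e).
Proof.
move=> dA; apply: (@edef_ext (fun e => forall i, i \in enum 'I_n -> A i e)).
  by move=> e; split=> H i; [apply: H; rewrite mem_enum|].
elim: (enum 'I_n) => [|i s IH].
  by apply: edef_ext (edef_eq1 0 0 c) => e; split.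
apply: edef_ext (edef_and (dA i) IH) => e; split.
  by move=> [Ai As] j; rewrite inE => /orP [/eqP ->|/As].
move=> H; split=> [|j js]; first by apply: H; rewrite inE eqxx.
by apply: H; rewrite inE js orbT.
Qed.

Lemma definable_diag n (c : M) :
  definable St (fun z : 'I_(n + n) -> M => lpart z = rpart z).
Proof.
apply: edef_definable.
apply: edef_ext (edef_forall_ord c (fun i : 'I_n => edef_eq1 (lshift n i) (rshift n i) c)).
move=> e; split=> [H|H i]; first exact: functional_extensionality.
exact: (f_equal (fun f => f i) H).
Qed.

Lemma edef_eq n (t s : (nat -> M) -> 'I_n -> M) (c : M) :
  tuple_term t -> tuple_term s -> edef (fun e => t e = s e).
Proof.
move=> Ht Hs; apply: edef_ext (edef_mem (definable_diag n c) (tterm_tcat Ht Hs)) => e.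
by rewrite lpart_tcat rpart_tcat.
Qed.

Lemma definable_ext n (X Y : ('I_n -> M) -> Prop) :
  (forall x, X x <-> Y x) -> definable St X -> definable St Y.
Proof. by move=> /pred_ext ->. Qed.

(** The conjunct [X (t e)] belongs to the atom: [def_map] controls the graph of [f] over [X]
    only. *)
Lemma edef_graph n m (X : ('I_n -> M) -> Prop) (Y : ('I_m -> M) -> Prop) f t s :
  def_map St X Y f -> tuple_term t -> tuple_term s ->
  edef (fun e => X (t e) /\ s e = f (t e)).
Proof.
move=> [_ Hf] Ht Hs; apply: edef_ext (edef_mem Hf (tterm_tcat Ht Hs)) => e.
by rewrite lpart_tcat rpart_tcat.
Qed.

Lemma edef_op_graph n (G : ('I_n -> M) -> Prop) mul t s r :
  definable St (op_graph G mul) -> tuple_term t -> tuple_term s -> tuple_term r ->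
  edef (fun e => G (t e) /\ G (s e) /\ r e = mul (t e) (s e)).
Proof.
move=> Hm Ht Hs Hr.
apply: edef_ext (edef_mem Hm (tterm_tcat (tterm_tcat Ht Hs) Hr)) => e.
by rewrite /op_graph !lpart_tcat !rpart_tcat.
Qed.

End Definability.

Ltac tterm := solve [repeat first
  [ assumption | apply: tterm_const | apply: tterm_var | apply: tterm_tcat | apply: tterm_lpart
  | apply: tterm_rpart | apply: tterm_rename ]].

Lemma definable_expand (L Ex : signature) (M : Type) (SM : structure L M)
  (SE : structure Ex M) n (X : ('I_n -> M) -> Prop) :
  definable SM X -> definable (expand SM SE) X.
Proof.
pose tmap := fix tmap (t : term L) : term (sig_sum L Ex) :=
  match t with
  | Var i => Var _ i
  | Fn f ts => @Fn (sig_sum L Ex) (inl f) (fun j => tmap (ts j))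
  end.
pose fmap := fix fmap (p : formula L) : formula (sig_sum L Ex) :=
  match p with
  | FEq t u => FEq (tmap t) (tmap u)
  | FRel r ts => @FRel (sig_sum L Ex) (inl r) (fun j => tmap (ts j))
  | FNot p => FNot (fmap p)
  | FAnd p q => FAnd (fmap p) (fmap q)
  | FEx i p => FEx i (fmap p)
  end.
have Ht t e : eval (expand SM SE) e (tmap t) = eval SM e t.
  elim: t => //= f ts IH; congr (sfun _); exact: functional_extensionality.
have Hf p : forall e, sat (expand SM SE) e (fmap p) <-> sat SM e p.
  elim: p => [t u|r ts|p IH|p IHp q IHq|i p IH] e /=.
  - by rewrite !Ht.
  - by have -> : (fun j => eval (expand SM SE) e (tmap (ts j))) = (fun j => eval SM e (ts j))
      by apply: functional_extensionality => j; rewrite Ht.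
  - by rewrite IH.
  - by rewrite IHp IHq.
  - by split=> -[a Ha]; exists a; apply/IH.
by move=> [phi [par H]]; exists (fmap phi), par => x; rewrite Hf.
Qed.

(** Graph atoms are themselves conjunctions, so they are tried before [edef_and] would split
    them. *)
Ltac edef c := cbv beta; repeat first
  [ apply: edef_op_graph; [eassumption|tterm|tterm|tterm]
  | apply: edef_graph; [eassumption|tterm|tterm]
  | apply: edef_mem; [eassumption|tterm]
  | apply: edef_and | apply: edef_or | apply: edef_not | apply: edef_ex
  | apply: (edef_eq _ c); [tterm|tterm] ].

(** * Dimension *)

Section Dimension.
Variables (L Ex : signature) (M : Type) (SM : structure L M) (SE : structure Ex M).
Variables (dim : dimfun M) (Hdim : dim_axioms SM SE dim) (c0 : M).
Local Notation defN := (definable (expand SM SE)).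
Local Notation defL := (definable SM).

Lemma dim_subset n (A B : ('I_n -> M) -> Prop) k : defN A -> defN B ->
  (forall x, A x -> B x) -> dlt (dim B) k -> dlt (dim A) k.
Proof.
move=> dA dB AB; have -> : B = (fun x => A x \/ B x).
  by apply: pred_ext => x; split; [right|case=> // /AB].
rewrite (dim_union Hdim dA dB); case: (dim A) => [a|] //; case: (dim B) => [b|] //=.
by rewrite gtn_max => /andP [].
Qed.

Lemma dlt_union n (A B : ('I_n -> M) -> Prop) k : defN A -> defN B ->
  dlt (dim A) k -> dlt (dim B) k -> dlt (dim (fun x => A x \/ B x)) k.
Proof.
move=> dA dB; rewrite (dim_union Hdim dA dB).
by case: (dim A) => [a|] //; case: (dim B) => [b|] //= *; rewrite gtn_max; apply/andP.
Qed.

(** Invariance under bijections for relations, which suits correspondences such as [s = mul g c]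
    that are solved for one variable only implicitly. *)
Lemma dim_rel_bij n1 n2 (A : ('I_n1 -> M) -> Prop) (B : ('I_n2 -> M) -> Prop)
    (R : ('I_n1 -> M) -> ('I_n2 -> M) -> Prop) :
  defN A -> defN B -> defN (fun z : 'I_(n1 + n2) -> M => R (lpart z) (rpart z)) ->
  (forall x, A x -> exists y, B y /\ R x y) ->
  (forall y, B y -> exists x, A x /\ R x y) ->
  (forall x y y', A x -> B y -> B y' -> R x y -> R x y' -> y = y') ->
  (forall x x' y, A x -> A x' -> B y -> R x y -> R x' y -> x = x') ->
  dim A = dim B.
Proof.
move=> dA dB dR AB BA Rfun Rinj.
have /fun_choice [f Hf] : forall x, exists y, A x -> B y /\ R x y.
  move=> x; case: (classic (A x)) => [/AB [y Hy]|nA]; first by exists y.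
  by exists (fun _ => c0).
apply: (dim_bij Hdim (f := f)) => //.
  split=> [x /Hf []//|].
  (* The map [f] comes from choice, but functionality of [R] identifies its graph over [A] with [R]
     restricted to [A] and [B]. *)
  apply: (@definable_ext _ _ _ _
    (fun z => A (lpart z) /\ B (rpart z) /\ R (lpart z) (rpart z))).
    move=> z; split=> [[Az [Bz Rz]]|[Az ->]]; last by have [] := Hf _ Az.
    by split=> //; have [Bf Rf] := Hf _ Az; apply: (Rfun _ _ _ Az).
  have dRz := edef_mem dR (@tterm_var M _ (fun i : 'I_(n1 + n2) => i : nat)).
  by apply: edef_definable; edef c0.
split=> [x /Hf []//|]; split=> [x x' Ax Ax' E|y By].
  have [Bf Rf] := Hf _ Ax; have [_ Rf'] := Hf _ Ax'.
  by apply: (Rinj _ _ (f x)) => //; rewrite E.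
have [x [Ax Rx]] := BA y By; exists x; split=> //.
by have [Bf Rf] := Hf _ Ax; apply: (Rfun x).
Qed.

Lemma dim_swap p n (D : ('I_(p + n) -> M) -> Prop) : defN D ->
  dim D = dim (fun z : 'I_(n + p) -> M => D (tcat (rpart z) (lpart z))).
Proof.
move=> dD; apply: (@dim_rel_bij _ _ _ _ (fun z w => z = tcat (rpart w) (lpart w))) => //.
- by apply: edef_definable; edef c0.
- by apply: edef_definable; edef c0.
- by move=> z Dz; exists (tcat (rpart z) (lpart z)); rewrite lpart_tcat rpart_tcat tcat_parts.
- by move=> w Dw; exists (tcat (rpart w) (lpart w)).
- move=> z w w' _ _ _ -> E; rewrite -[w]tcat_parts -[w']tcat_parts.
  have := f_equal (@rpart _ _ _) E; have := f_equal (@lpart _ _ _) E.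
  by rewrite !lpart_tcat !rpart_tcat => -> ->.
- by move=> z z' w _ _ _ -> ->.
Qed.

(* The graph [{(t, (t, x)) | D (t, x)}] turns any family into a disjoint one. *)
Definition disjointified p n (D : ('I_(p + n) -> M) -> Prop) :
    ('I_(p + (p + n)) -> M) -> Prop :=
  fun z => lpart z = lpart (rpart z) /\ D (rpart z).

Lemma disjointified_disjoint p n I (D : ('I_(p + n) -> M) -> Prop) :
  disjoint_family I (disjointified D).
Proof.
move=> t t' x _ _ neq [+ _] [+ _].
by rewrite !lpart_tcat !rpart_tcat => E E'; apply: neq; rewrite E.
Qed.

Lemma definable_fiber (S : signature) (St : structure S M) p n
    (D : ('I_(p + n) -> M) -> Prop) t : definable St D -> definable St (fiber D t).
Proof. by move=> dD; apply: edef_definable; rewrite /fiber; edef c0. Qed.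

Lemma definable_disjointified (S : signature) (St : structure S M) p n
    (D : ('I_(p + n) -> M) -> Prop) : definable St D -> definable St (disjointified D).
Proof. by move=> dD; apply: edef_definable; rewrite /disjointified; edef c0. Qed.

Lemma dim_fiber_disjointified p n (D : ('I_(p + n) -> M) -> Prop) t : defN D ->
  dim (fiber (disjointified D) t) = dim (fiber D t).
Proof.
move=> dD; apply: (@dim_rel_bij _ _ _ _ (fun z x => rpart z = x)).
- by apply: definable_fiber; apply: definable_disjointified.
- exact: definable_fiber.
- by apply: edef_definable; edef c0.
- move=> z [+ Dz]; rewrite lpart_tcat rpart_tcat => E; exists (rpart z); split=> //.
  by move: Dz; rewrite /fiber rpart_tcat E tcat_parts.
- move=> x Dx; exists (tcat t x); rewrite /fiber /disjointified.
  by rewrite !rpart_tcat !lpart_tcat.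
- by move=> z y y' _ _ _ <- <-.
- move=> z z' y [+ _] [+ _] _; rewrite !lpart_tcat !rpart_tcat => E E' Ez Ez'.
  by rewrite -[z]tcat_parts -[z']tcat_parts -E -E' Ez Ez'.
Qed.

(** The total space is the union of the disjointified fibers, so additivity of dimension extends to
    overlapping families. *)
Lemma dim_fibration p n (I : ('I_p -> M) -> Prop) (D : ('I_(p + n) -> M) -> Prop) k :
  defN I -> defN D -> (forall t, I t -> dim (fiber D t) = Some k) ->
  dim (fun z => I (lpart z) /\ D z) = omap (addn k) (dim I).
Proof.
move=> dI dD Hk.
rewrite -(dim_family Hdim (D := disjointified D) (k := k) dI).
- congr (dim _); apply: pred_ext => z; split=> [[Iz Dz]|[t [It []]]].
    by exists (lpart z); split=> //; split; rewrite ?lpart_tcat rpart_tcat.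
  by rewrite lpart_tcat rpart_tcat => <-.
- exact: definable_disjointified.
- exact: disjointified_disjoint.
- by move=> t It; rewrite dim_fiber_disjointified // Hk.
Qed.

(** Disjointification likewise frees definability of dimension from disjointness. *)
Lemma definable_fiber_dim p n (I : ('I_p -> M) -> Prop) (D : ('I_(p + n) -> M) -> Prop) d :
  defL I -> defL D -> defL (fun t => I t /\ dim (fiber D t) = d).
Proof.
move=> dI dD.
have := dim_Ldef Hdim d dI (definable_disjointified dD) (@disjointified_disjoint _ _ _ _).
apply: definable_ext => t; rewrite dim_fiber_disjointified //.
exact: definable_expand.
Qed.

End Dimension.

(** Serves to delete a set of dimension below [k] from a set of dimension [k]. *)
Lemma dmax_small a b k : dlt b k -> dmax a b = Some k -> a = Some k.
Proof.
case: a b => [a|] [b|] //= ltb [E]; last by rewrite E ltnn in ltb.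
by congr Some; move: ltb; rewrite -E leq_max ltnn orbF => /ltnW /maxn_idPl ->.
Qed.

(** * Group chunks *)

Section GroupChunk.
Variables (L Ex : signature) (M : Type) (SM : structure L M) (SE : structure Ex M).
Variables (dim : dimfun M) (Hdim : dim_axioms SM SE dim) (c0 : M).
Local Notation defN := (definable (expand SM SE)).
Local Notation defL := (definable SM).
Variables (n : nat) (G : ('I_n -> M) -> Prop).
Variables (mul : ('I_n -> M) -> ('I_n -> M) -> ('I_n -> M)) (one : 'I_n -> M).
Hypotheses (dG : defN G) (dmul : defN (op_graph G mul)) (gG : is_group G mul one).
Variables (k : nat) (HdimG : dim G = Some k).

(** * Group algebra and generic translates *)

Lemma group_closed x y : G x -> G y -> G (mul x y).
Proof. by case: gG => _ [H _]; apply: H. Qed.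

Lemma group_assoc x y z : G x -> G y -> G z -> mul (mul x y) z = mul x (mul y z).
Proof. by case: gG => _ [_ [H _]]; apply: H. Qed.

Lemma group_mul1 x : G x -> mul one x = x.
Proof. by case: gG => _ [_ [_ [H _]]] /H []. Qed.

Lemma group_mulI g x y : G g -> G x -> G y -> mul g x = mul g y -> x = y.
Proof.
case: gG => _ [_ [_ [_ H]]] Gg Gx Gy E; have [g' [Gg' [_ Hg]]] := H g Gg.
by rewrite -(group_mul1 Gx) -(group_mul1 Gy) -Hg !group_assoc // E.
Qed.

Lemma group_mulIr g x y : G g -> G x -> G y -> mul x g = mul y g -> x = y.
Proof.
case: gG => _ [_ [_ [H1 H]]] Gg Gx Gy E; have [g' [Gg' [Hg _]]] := H g Gg.
by rewrite -(proj2 (H1 _ Gx)) -(proj2 (H1 _ Gy)) -Hg -!group_assoc // E.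
Qed.

Lemma group_divl g s : G g -> G s -> exists x, G x /\ s = mul g x.
Proof.
case: gG => _ [_ [_ [_ H]]] Gg Gs; have [g' [Gg' [Hg _]]] := H g Gg.
exists (mul g' s); split; first exact: group_closed.
by rewrite -group_assoc // Hg group_mul1.
Qed.

Lemma group_divr x s : G x -> G s -> exists g, G g /\ s = mul g x.
Proof.
case: gG => _ [_ [_ [H1 H]]] Gx Gs; have [x' [Gx' [_ Hx]]] := H x Gx.
exists (mul s x'); split; first exact: group_closed.
by rewrite group_assoc // Hx (proj2 (H1 _ Gs)).
Qed.

(* If all [S \ gV] with [g] in [V] had the dimension of [S], then
   [{(g, s) | g \in V, s \in S \ gV}] would have dimension [k + dim S]; but it lies in
   [{(g, s) | g \in G, s \in S \ gV}], whose fiber over [s] is in bijection with the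
   small set [G \ V]. *)
Lemma translate_drop_dim (V S : ('I_n -> M) -> Prop) d :
  defN V -> defN S -> (forall g, V g -> G g) -> (forall g, S g -> G g) ->
  dim V = Some k -> dlt (dim (fun g => G g /\ ~ V g)) k -> dim S = Some d ->
  exists g, V g /\ dlt (dim (fun s => S s /\ ~ exists v, V v /\ s = mul g v)) d.
Proof.
move=> dV dS VG SG dimV smallV dimS; apply: NNPP => no.
pose out (z : 'I_(n + n) -> M) := S (rpart z) /\
  ~ exists v, V v /\ G (lpart z) /\ G v /\ rpart z = mul (lpart z) v.
have dout : defN out by apply: edef_definable; rewrite /out; edef c0.
have outP g s : G g -> out (tcat g s) <-> S s /\ ~ exists v, V v /\ s = mul g v.
  move=> Gg; rewrite /out lpart_tcat rpart_tcat; split=> -[Ss H]; split=> // -[v].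
    by move=> [Vv E]; apply: H; exists v; split=> //; split=> //; split=> //; apply: VG.
  by move=> [Vv [_ [_ E]]]; apply: H; exists v.
have dim_out g : V g -> dim (fiber out g) = Some d.
  move=> Vg; have Gg := VG _ Vg.
  have E : fiber out g = (fun s => S s /\ ~ exists v, V v /\ s = mul g v).
    by apply: pred_ext => s; apply: outP.
  have : dlt (dim (fiber out g)) d.+1.
    apply: (dim_subset Hdim (B := S)) => //; last by rewrite dimS /=.
      exact: definable_fiber.
    by move=> s /(outP _ _ Gg) [].
  (* The negated conclusion excludes dimensions below [d]; inclusion in [S] excludes those above. *)
  have : ~ dlt (dim (fiber out g)) d by move=> lt; apply: no; exists g; rewrite -E.
  case: (dim _) => [x|] /=; last by case.
  by move=> /negP; rewrite -leqNgt ltnS => le1 le2; congr Some; apply/eqP; rewrite eqn_leq le1 le2.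
have dimW := dim_fibration Hdim c0 dV dout dim_out.
rewrite dimV /= in dimW.
set W := (fun z => _) in dimW.
have dW : defN W by apply: edef_definable; rewrite /W; edef c0.
pose out' (z : 'I_(n + n) -> M) := G (rpart z) /\ out (tcat (rpart z) (lpart z)).
have dout' : defN out' by apply: edef_definable; rewrite /out'; edef c0.
set C := (fun g => G g /\ ~ V g) in smallV.
have dC : defN C by apply: edef_definable; rewrite /C; edef c0.
have dim_out' s : S s -> dim (fiber out' s) = dim C.
  move=> Ss; have Gs := SG _ Ss.
  (* Solving [s = mul g c] for [c], the point [s] avoids the translate of [V] by [g] exactly when
     [c] is outside [V]. *)
  apply: (dim_rel_bij Hdim c0 (R := fun g c => G g /\ G c /\ s = mul g c)) => //.
  - exact: definable_fiber.
  - by apply: edef_definable; edef c0.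
  - move=> g; rewrite /fiber /out' lpart_tcat rpart_tcat => -[Gg /(outP _ _ Gg) [_ H]].
    have [x [Gx E]] := group_divl Gg Gs; exists x; split=> //; split=> // Vx.
    by apply: H; exists x.
  - move=> c [Gc nVc]; have [g [Gg E]] := group_divr Gc Gs; exists g; split=> //.
    rewrite /fiber /out' lpart_tcat rpart_tcat; split=> //; apply/(outP _ _ Gg).
    split=> // -[v [Vv E']]; apply: nVc.
    by have -> : c = v by apply: (group_mulI Gg) => //; [apply: VG|rewrite -E].
  - move=> g y y' _ _ _ [Gg [Gy ->]] [_ [Gy' E]].
    exact: (group_mulI Gg).
  - move=> g g' y _ _ _ [Gg [Gy ->]] [Gg' [_ E]].
    exact: (group_mulIr Gy).
pose W' (z : 'I_(n + n) -> M) := S (lpart z) /\ out' z.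
have dW' : defN W' by apply: edef_definable; rewrite /W'; edef c0.
have smallW' : dlt (dim W') (d + k).
  (* [dim_fibration] takes a natural number as fiber dimension; if [C] is empty, so are the fibers
     and [W']. *)
  case EC: (dim C) smallV => [c|] /= ltc.
    rewrite (dim_fibration Hdim c0 dS dout' (k := c)) ?dimS /=.
      by rewrite addnC ltn_add2l.
    by move=> s Ss; rewrite dim_out'.
  suff -> : dim W' = None by [].
  apply/(dim_empty Hdim dW') => z [Sz out'z].
  have : dim (fiber out' (lpart z)) = None by rewrite dim_out'.
  move/(dim_empty Hdim (definable_fiber _ dout')) => /(_ (rpart z)); apply.
  by rewrite /fiber tcat_parts.
suff : dlt (dim W) (d + k) by rewrite dimW /= ltnn.
rewrite (dim_swap Hdim c0 dW); apply: (dim_subset Hdim _ dW') smallW'.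
  by apply: edef_definable; edef c0.
move=> z [+ oz]; rewrite lpart_tcat => Vz; split; last by split=> //; apply: VG.
by case: oz; rewrite rpart_tcat.
Qed.

(** * The chunk and its good points *)

Variables (m : nat) (X : ('I_m -> M) -> Prop) (Z : ('I_(m + m) -> M) -> Prop).
Hypotheses (HX : defL X) (HZ : defL Z) (HZX : forall z, Z z -> sqset X z).
Hypothesis HXZ : dlt (dim (fun z => sqset X z /\ ~ Z z)) (2 * k).
Variable h : ('I_m -> M) -> ('I_n -> M).
Hypothesis Hh : def_map (expand SM SE) X G h.
Hypothesis Hhinj : forall x x', X x -> X x' -> h x = h x' -> x = x'.
Hypothesis HhX : dlt (dim (fun g => G g /\ ~ (exists x, X x /\ h x = g))) k.
Variable F : ('I_(m + m) -> M) -> ('I_m -> M).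
Hypothesis HF : def_map SM (sqset X) X F.
Hypothesis HFZ : forall z, Z z -> mul (h (lpart z)) (h (rpart z)) = h (F z).

Let dX : defN X := definable_expand _ HX.
Let dZ : defN Z := definable_expand _ HZ.

Lemma chunk_mem x : X x -> G (h x).
Proof. by case: Hh => H _; apply: H. Qed.

Definition image_h (A : ('I_m -> M) -> Prop) : ('I_n -> M) -> Prop :=
  fun g => exists x, A x /\ X x /\ g = h x.

Lemma definable_image_h A : defN A -> defN (image_h A).
Proof. by move=> dA; apply: edef_definable; rewrite /image_h; edef c0. Qed.

Lemma dim_image_h A : defN A -> (forall x, A x -> X x) -> dim (image_h A) = dim A.
Proof.
move=> dA AX; symmetry.
apply: (dim_rel_bij Hdim c0 (R := fun x g => X x /\ g = h x)) => //.
- exact: definable_image_h.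
- by apply: edef_definable; edef c0.
- by move=> x Ax; have Xx := AX _ Ax; exists (h x); split=> //; exists x.
- by move=> x y y' _ _ _ [_ ->] [_ ->].
- by move=> x x' y _ _ _ [Xx ->] [Xx']; apply: Hhinj.
Qed.

(** By injectivity [h] preserves the dimension of [X], and the rest of [G] is too small to account
    for [k]. *)
Lemma dim_chunk : dim X = Some k.
Proof.
have := HdimG; have -> : G = (fun g => image_h X g \/ (G g /\ ~ exists x, X x /\ h x = g)).
  apply: pred_ext => g; split=> [Gg|[[x [_ [Xx ->]]]|[]//]]; last exact: chunk_mem.
  case: (classic (exists x, X x /\ h x = g)) => [[x [Xx <-]]|]; [left; exists x|right] => //.
have dI := definable_image_h dX.
rewrite (dim_union Hdim dI); last first.
  apply: (@definable_ext _ _ _ _ (fun g => G g /\ ~ image_h X g)).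
    move=> g; split=> -[Gg H]; split=> // -[x Hx]; apply: H; exists x.
      by case: Hx => ? <-.
    by case: Hx => _ [? ->].
  by apply: edef_definable; edef c0.
rewrite dim_image_h //; move: HhX.
exact: dmax_small.
Qed.

(** The coordinates are swapped so that the family is indexed by the right factor: the fiber over
    [x] consists of the [z] with [(z, x)] outside [Z]. *)
Definition bad_pair (w : 'I_(m + m) -> M) : Prop :=
  X (rpart w) /\ ~ Z (tcat (rpart w) (lpart w)).

Definition bad_point (x : 'I_m -> M) : Prop :=
  X x /\ dim (fiber bad_pair x) = Some k.

Definition good_point (x : 'I_m -> M) : Prop := X x /\ ~ bad_point x.

Lemma definable_bad_pair : defL bad_pair.
Proof. by apply: edef_definable; rewrite /bad_pair; edef c0. Qed.

(** Definability of dimension in [SM] enters here: it keeps the choice of good points within the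
    language [L]. *)
Lemma definable_bad_point : defL bad_point.
Proof. exact (definable_fiber_dim Hdim c0 (Some k) HX definable_bad_pair). Qed.

Lemma definable_good_point : defL good_point.
Proof.
have dbad := definable_bad_point.
by apply: edef_definable; rewrite /good_point; edef c0.
Qed.

Let dbadN : defN bad_point := definable_expand _ definable_bad_point.
Let dgoodN : defN good_point := definable_expand _ definable_good_point.
Let dbadpN : defN bad_pair := definable_expand _ definable_bad_pair.

(** The bad pairs over bad points have dimension [k + dim bad_point] and embed, after a swap, in the
    complement of [Z], of dimension below [2 * k]. *)
Lemma bad_point_small : dlt (dim bad_point) k.
Proof.
have Efib x : bad_point x -> dim (fiber bad_pair x) = Some k by case.
have := dim_fibration Hdim c0 dbadN dbadpN Efib.
set W := (fun z => _) => dimW.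
have dW : defN W by apply: edef_definable; rewrite /W; edef c0.
have dB : defN (fun z => sqset X z /\ ~ Z z).
  by apply: edef_definable; rewrite /sqset; edef c0.
have : dlt (dim W) (2 * k).
  rewrite (dim_swap Hdim c0 dW); apply: (dim_subset Hdim _ dB) HXZ.
    by apply: edef_definable; edef c0.
  move=> z [+ [+ +]]; rewrite lpart_tcat rpart_tcat => -[Xr _] Xl.
  by rewrite tcat_parts; split.
by rewrite dimW; case: (dim bad_point) => [b|] //=; rewrite mul2n -addnn ltn_add2l.
Qed.

Lemma good_pointP x : good_point x -> dlt (dim (fun z => X z /\ ~ Z (tcat z x))) k.
Proof.
move=> [Xx nb].
have E : fiber bad_pair x = (fun z => X z /\ ~ Z (tcat z x)).
  by apply: pred_ext => z; rewrite /fiber /bad_pair lpart_tcat rpart_tcat.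
have : dlt (dim (fiber bad_pair x)) k.+1.
  apply: (dim_subset Hdim _ dX); first exact: definable_fiber.
    by rewrite E => z [].
  by rewrite dim_chunk /=.
have : dim (fiber bad_pair x) <> Some k by move=> Ek; apply: nb.
rewrite E; case: (dim _) => [b|] //= neq; rewrite ltnS leq_eqVlt => /orP [/eqP Eb|//].
by case: neq; rewrite Eb.
Qed.

Lemma dim_good_point : dim good_point = Some k.
Proof.
have := dim_chunk; have -> : X = (fun x => good_point x \/ bad_point x).
  apply: pred_ext => x; rewrite /good_point; split=> [Xx|[[]|[]]] //.
  by case: (classic (bad_point x)); [right|left].
rewrite (dim_union Hdim) //; move: bad_point_small.
exact: dmax_small.
Qed.

Lemma compl_good_small : dlt (dim (fun g => G g /\ ~ image_h good_point g)) k.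
Proof.
have dIg := definable_image_h dgoodN; have dIb := definable_image_h dbadN.
have dIX := definable_image_h dX.
have dC : defN (fun g => G g /\ ~ image_h X g).
  by apply: edef_definable; edef c0.
apply: (dim_subset Hdim (B := fun g => (G g /\ ~ image_h X g) \/ image_h bad_point g)).
- by apply: edef_definable; edef c0.
- by apply: edef_definable; edef c0.
- move=> g [Gg ng]; case: (classic (image_h X g)) => [[x [Xx [_ Eg]]]|]; [right|left] => //.
  exists x; split=> //; apply: NNPP => nb; apply: ng; exists x; split=> //.
apply: (dlt_union Hdim) => //.
  move: HhX; congr (dlt (dim _) _); apply: pred_ext => g.
  split=> -[Gg H]; split=> // -[x Hx]; apply: H; exists x; last by case: Hx => ? <-.
  by case: Hx => _ [? ->].
by rewrite dim_image_h //; [apply: bad_point_small|move=> x []].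
Qed.

(** * Products read along chains of [F] *)

(* [fchain [:: x_r; ...; x_1] z w]: iterating [F] from [z] along [x_1, ..., x_r], without
   leaving [Z], ends at [w]. *)
Fixpoint fchain (l : seq ('I_m -> M)) (z w : 'I_m -> M) : Prop :=
  match l with
  | [::] => X z /\ w = z
  | x :: l' => exists v, fchain l' z v /\ Z (tcat v x) /\ (sqset X (tcat v x) /\ w = F (tcat v x))
  end.

(** The head is the last factor, since [fchain] applies the head last. *)
Fixpoint hprod (l : seq ('I_m -> M)) : 'I_n -> M :=
  match l with
  | [::] => one
  | x :: l' => mul (hprod l') (h x)
  end.

Fixpoint all_good (l : seq ('I_m -> M)) : Prop :=
  match l with
  | [::] => True
  | x :: l' => good_point x /\ all_good l'
  end.

Fixpoint all_tterm (ts : seq ((nat -> M) -> 'I_m -> M)) : Prop :=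
  match ts with
  | [::] => True
  | t :: ts' => tuple_term t /\ all_tterm ts'
  end.

(** The renaming [rho] makes the induction go through: each intermediate point is a new quantified
    tuple, which shifts the variables of the remaining list by [m]. *)
Lemma edef_fchain_rename ts (s r : (nat -> M) -> 'I_m -> M) (rho : nat -> nat) :
  all_tterm ts -> tuple_term s -> tuple_term r ->
  edef SM (fun e => fchain [seq t (fun i => e (rho i)) | t <- ts] (s e) (r e)).
Proof.
elim: ts s r rho => [|t ts IH] s r rho /= Hts Hs Hr; first by edef c0.
have [Ht {}Hts] := Hts.
apply: edef_ex; apply: edef_and; last by edef c0.
by apply: (IH (fun e => s (fun i => e (m + i))) (fun e i => e i) (fun i => m + rho i));
  [|tterm|tterm].
Qed.

Lemma edef_fchain ts (s r : (nat -> M) -> 'I_m -> M) :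
  all_tterm ts -> tuple_term s -> tuple_term r ->
  edef SM (fun e => fchain [seq t e | t <- ts] (s e) (r e)).
Proof. exact: (@edef_fchain_rename ts s r id). Qed.

Lemma hprod_mem l : all_good l -> G (hprod l).
Proof.
elim: l => [|x l IH] /= H; first by case: gG.
by have [[Xx _] Hl] := H; apply: group_closed; [apply: IH|apply: chunk_mem].
Qed.

(** Inside [Z], applying [F] with [x] on the right is right multiplication by [h x]. *)
Lemma fchainP l z w : all_good l -> fchain l z w ->
  X z /\ X w /\ h w = mul (h z) (hprod l).
Proof.
elim: l w => [|x l IH] w /=.
  move=> _ [Xz ->]; split=> //; split=> //.
  by case: gG => _ [_ [_ [H _]]]; have [_ ->] := H _ (chunk_mem Xz).
move=> [[Xx _] gl] [v [/(IH _ gl) [Xz [Xv Ev]] [Zv [sq ->]]]]; split=> //.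
split; first by case: HF => H _; apply: H.
rewrite -HFZ // lpart_tcat rpart_tcat Ev group_assoc //; [exact: chunk_mem|exact: hprod_mem|].
exact: chunk_mem.
Qed.

Lemma edef_fchain_params l (t s : (nat -> M) -> 'I_m -> M) :
  tuple_term t -> tuple_term s -> edef (expand SM SE) (fun e => fchain l (t e) (s e)).
Proof.
have dch : defN (fun zw => fchain l (lpart zw) (rpart zw)).
  apply: definable_expand; apply: edef_definable.
  have := @edef_fchain [seq (fun _ => x) | x <- l]
    (fun e => lpart (fun i : 'I_(m + m) => e i)) (fun e => rpart (fun i : 'I_(m + m) => e i)).
  have E e : [seq t e | t <- [seq (fun _ : nat -> M => x) | x <- l]] = l.
    by rewrite -map_comp map_id.
  have Hl : all_tterm [seq (fun _ : nat -> M => x) | x <- l].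
    by elim: l {E} => //= x l IH; split=> //; tterm.
  move=> /(_ Hl ltac:(tterm) ltac:(tterm)); apply: edef_ext => e.
  by rewrite E.
move=> Ht Hs; apply: edef_ext (edef_mem dch (tterm_tcat Ht Hs)) => e.
by rewrite lpart_tcat rpart_tcat.
Qed.

Lemma definable_no_fchain l : defN (fun z => X z /\ ~ exists w, fchain l z w).
Proof. by apply: edef_definable; edef c0; apply: edef_fchain_params; tterm. Qed.

(* On chains along [l], [z |-> w] is injective, since [h w = h z * hprod l]; so only few
   starting points [z] lead to a [w] at which the chain cannot be continued. *)
Lemma fchain_generic l : all_good l -> dlt (dim (fun z => X z /\ ~ exists w, fchain l z w)) k.
Proof.
have dbad := definable_no_fchain; have ech := edef_fchain_params.
elim: l => [|x l IH] /= gl.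
  suff -> : dim (fun z => X z /\ ~ exists w, X z /\ w = z) = None by [].
  by apply/(dim_empty Hdim (dbad [::])) => z [Xz]; apply; exists z.
have [gx {}gl] := gl.
pose stuck z := exists v, fchain l z v /\ ~ Z (tcat v x).
have dstuck : defN stuck.
  by apply: edef_definable; rewrite /stuck; edef c0; apply: ech; tterm.
apply: (dim_subset Hdim (B := fun z => (X z /\ ~ exists w, fchain l z w) \/ stuck z)).
- exact: (dbad (x :: l)).
- have d1 := dbad l; apply: edef_definable; apply: edef_or; last by edef c0.
  by apply: edef_mem d1 _; tterm.
- move=> z [Xz nch]; case: (classic (exists w, fchain l z w)) => [[v cv]|]; [right|left] => //.
  exists v; split=> // Zv; apply: nch; exists (F (tcat v x)), v; split=> //; split=> //.
  by split=> //; apply: HZX.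
apply: (dlt_union Hdim) => //; first exact: IH.
pose ends v := exists z, fchain l z v /\ ~ Z (tcat v x).
have dends : defN ends.
  by apply: edef_definable; rewrite /ends; edef c0; apply: ech; tterm.
have -> : dim stuck = dim ends.
  apply: (dim_rel_bij Hdim c0 (R := fun z v => fchain l z v)) => //.
  - by apply: edef_definable; apply: ech; tterm.
  - by move=> z [v [cv nZ]]; exists v; split=> //; exists z.
  - by move=> v [z [cv nZ]]; exists z; split=> //; exists v.
  - move=> z v v' _ _ _ /(fchainP gl) [_ [Xv Ev]] /(fchainP gl) [_ [Xv' Ev']].
    by apply: Hhinj; rewrite // Ev.
  - move=> z z' v _ _ _ /(fchainP gl) [Xz [Xv Ev]] /(fchainP gl) [Xz' [_ Ev']].
    apply: Hhinj => //; apply: (group_mulIr (hprod_mem gl)); rewrite -?Ev //; exact: chunk_mem.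
apply: (dim_subset Hdim dends _ _ (good_pointP gx)).
  by apply: edef_definable; edef c0.
by move=> v [z [/(fchainP gl) [_ [Xv _]] nZ]].
Qed.

(** An [L]-definable substitute for equality of products: it speaks of chains in [X] and mentions
    neither [h] nor [mul]. *)
Definition same_prod (l1 l2 : seq ('I_m -> M)) : Prop :=
  exists z, exists w, fchain l1 z w /\ fchain l2 z w.

Lemma same_prodP l1 l2 : all_good l1 -> all_good l2 ->
  same_prod l1 l2 <-> hprod l1 = hprod l2.
Proof.
move=> g1 g2; split=> [[z [w [/(fchainP g1) [Xz [Xw E1]] /(fchainP g2) [_ [_ E2]]]]]|E].
  by apply: (group_mulI (chunk_mem Xz)); rewrite -?E1 //; apply: hprod_mem.
have d1 := definable_no_fchain l1; have d2 := definable_no_fchain l2.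
apply: NNPP => no.
suff : dlt (dim X) k by rewrite dim_chunk /= ltnn.
(* If both chains from [z] exist, their ends agree by injectivity of [h]. So without a common start
   and end, [X] is covered by two sets of dimension below [k]. *)
apply: (dim_subset Hdim dX _ _ (dlt_union Hdim d1 d2 (fchain_generic g1) (fchain_generic g2))).
  by apply: edef_definable; apply: edef_or; [apply: edef_mem d1 _|apply: edef_mem d2 _]; tterm.
move=> z Xz; case: (classic (exists w, fchain l1 z w)) => [[w1 c1]|]; last by left.
right; split=> // -[w2 c2]; apply: no; exists z, w1; split=> //.
have [_ [X1 E1]] := fchainP g1 c1; have [_ [X2 E2]] := fchainP g2 c2.
by have -> : w1 = w2 by apply: Hhinj; rewrite // E1 E2 E.
Qed.

Lemma edef_same_prod ts1 ts2 : all_tterm ts1 -> all_tterm ts2 ->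
  edef SM (fun e => same_prod [seq t e | t <- ts1] [seq t e | t <- ts2]).
Proof.
(* The shift by [m + m] makes room for the quantified tuples [z] and [w]. *)
have sh ts : all_tterm ts -> all_tterm [seq (fun e => t (fun i => e (m + (m + i)))) | t <- ts].
  by elim: ts => //= t ts IH [Ht /IH Hts]; split=> //; tterm.
move=> /sh H1 /sh H2; apply: edef_ex; apply: edef_ex; cbv beta.
have t0 : tuple_term (fun (e : nat -> M) (i : 'I_m) => e i) by tterm.
have t1 : tuple_term (fun (e : nat -> M) (i : 'I_m) => e (m + i)) by tterm.
have := edef_and (edef_fchain H1 t1 t0) (edef_fchain H2 t1 t0).
by apply: edef_ext => e; rewrite -!map_comp.
Qed.

(** * Covering the group by finitely many translates *)

Definition pair_prod (z : 'I_(m + m) -> M) : 'I_n -> M :=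
  mul (h (lpart z)) (h (rpart z)).

Lemma hprod_pair z : X (lpart z) -> hprod [:: rpart z; lpart z] = pair_prod z.
Proof. by move=> Xl; rewrite /= group_mul1 //; apply: chunk_mem. Qed.

Lemma edef_pair_prod t s : tuple_term t -> tuple_term s ->
  edef (expand SM SE) (fun e => sqset X (t e) /\ s e = pair_prod (t e)).
Proof.
move=> Ht Hs.
apply: (@edef_ext _ _ _ (fun e => exists u, exists v,
  (X (lpart (t e)) /\ u = h (lpart (t e))) /\
  ((X (rpart (t e)) /\ v = h (rpart (t e))) /\ (G u /\ G v /\ s e = mul u v)))).
  move=> e; split=> [[u [v [[Xl ->] [[Xr ->] [_ [_ E]]]]]]|[[Xl Xr] E]]; first by split.
  exists (h (lpart (t e))), (h (rpart (t e))); split=> //; split=> //.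
  by split; [|split] => //; apply: chunk_mem.
by edef c0.
Qed.

(** An [L]-definable set of pairs of good points on which the product map is injective; goodness
    makes [same_prod] applicable to its members. *)
Definition partial_section (T : ('I_(m + m) -> M) -> Prop) : Prop :=
  [/\ defL T, forall z, T z -> good_point (lpart z) /\ good_point (rpart z) &
      forall z z', T z -> T z' -> pair_prod z = pair_prod z' -> z = z'].

Definition uncovered (T : ('I_(m + m) -> M) -> Prop) : ('I_n -> M) -> Prop :=
  fun g => G g /\ ~ exists z, T z /\ g = pair_prod z.

Lemma definable_uncovered T : partial_section T -> defN (uncovered T).
Proof.
move=> [dT Tg _]; have {}dT : defN T := definable_expand _ dT.
apply: (@definable_ext _ _ _ _
  (fun g => G g /\ ~ exists z, T z /\ (sqset X z /\ g = pair_prod z))).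
  move=> g; split=> -[Gg H]; split=> // -[z Hz]; apply: H; exists z; last by case: Hz => ? [].
  by case: Hz => Tz ->; split=> //; split=> //; have [[? _] [? _]] := Tg _ Tz.
apply: edef_definable; apply: edef_and; first by edef c0.
apply: edef_not; apply: edef_ex; apply: edef_and; first by edef c0.
by apply: edef_pair_prod; tterm.
Qed.

(* Adds the part of the translate [h a * h(good_point)] that is not covered yet. *)
Lemma extend_section T d : partial_section T -> dim (uncovered T) = Some d ->
  exists T', partial_section T' /\ dlt (dim (uncovered T')) d.
Proof.
move=> sT dimU; have dU := definable_uncovered sT; have [dT Tg Tinj] := sT.
have dV := definable_image_h dgoodN.
have VG g : image_h good_point g -> G g by move=> [x [_ [Xx ->]]]; apply: chunk_mem.
have UG g : uncovered T g -> G g by case.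
have dimV : dim (image_h good_point) = Some k.
  by rewrite dim_image_h ?dim_good_point // => x [].
have [g [[a [ga [Xa ->]]] small]] := translate_drop_dim dV dU VG UG dimV compl_good_small dimU.
pose T' z := T z \/ (lpart z = a /\ (good_point (rpart z) /\
  ~ exists t, T t /\ same_prod [:: rpart z; lpart z] [:: rpart t; lpart t])).
have dg := definable_good_point.
(* [T'] is phrased with [same_prod] to stay [L]-definable; for good pairs this says that the product
   is already attained on [T]. *)
have new z : good_point (lpart z) -> good_point (rpart z) ->
    (exists t, T t /\ same_prod [:: rpart z; lpart z] [:: rpart t; lpart t]) <->
    (exists t, T t /\ pair_prod z = pair_prod t).
  move=> gl gr; split=> -[t [Tt H]]; exists t; split=> //.
    have [tl tr] := Tg _ Tt; have [Xl _] := gl; have [Xtl _] := tl.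
    by move/same_prodP: H; rewrite !hprod_pair //; apply.
  have [tl tr] := Tg _ Tt; have [Xl _] := gl; have [Xtl _] := tl.
  by apply/same_prodP => //; rewrite !hprod_pair.
exists T'; split.
  split.
  - apply: edef_definable; apply: edef_or; first by edef c0.
    apply: edef_and; first by edef c0.
    apply: edef_and; first by edef c0.
    apply: edef_not; apply: edef_ex; apply: edef_and; first by edef c0.
    have /= := @edef_same_prod
      [:: fun e => rpart (fun i : 'I_(m + m) => e (m + m + i));
          fun e => lpart (fun i : 'I_(m + m) => e (m + m + i))]
      [:: fun e : nat -> M => rpart (fun i : 'I_(m + m) => e i);
          fun e : nat -> M => lpart (fun i : 'I_(m + m) => e i)].
    by apply; (split; [|split]) => //; tterm.
  - by move=> z [/Tg//|[-> []]].
  - have mix z z' : T z -> lpart z' = a -> good_point (rpart z') ->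
      ~ (exists t, T t /\ same_prod [:: rpart z'; lpart z'] [:: rpart t; lpart t]) ->
      pair_prod z' = pair_prod z -> False.
      by move=> Tz Ea gr H E; apply: H; apply/new; rewrite ?Ea //; exists z.
    move=> z z' [Tz|[Ea [gr H]]] [Tz'|[Ea' [gr' H']]] E.
    + exact: Tinj.
    + by case: (mix z z').
    + by case: (mix z' z).
    (* Both new pairs start with [a]: cancel [h a], then use injectivity of [h]. *)
    + rewrite -[z]tcat_parts -[z']tcat_parts Ea Ea'; congr tcat.
      case: gr gr' => Xr _ [Xr' _].
      move: E; rewrite /pair_prod Ea Ea' => /(group_mulI (chunk_mem Xa)) E.
      by apply: Hhinj => //; apply: E; apply: chunk_mem.
(* What [T'] leaves uncovered is what the translate of [image_h good_point] by [h a] leaves of the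
   set uncovered by [T]. *)
move: small; congr (dlt (dim _) _); apply: pred_ext => {}g; split.
  move=> [[Gg H1] H2]; split=> // -[z [[Tz|[Ea [gr _]]] E]]; first by apply: H1; exists z.
  apply: H2; exists (h (rpart z)); rewrite -Ea; split=> //.
  by case: (gr) => Xr _; exists (rpart z).
move=> [Gg H]; split; first by split=> // -[z [Tz E]]; apply: H; exists z; split=> //; left.
move=> [v [[x [gx [Xx ->]]] E]].
have Ez : pair_prod (tcat a x) = g by rewrite /pair_prod lpart_tcat rpart_tcat.
case: (classic (exists t, T t /\ pair_prod (tcat a x) = pair_prod t)) => [[t [Tt Et]]|no].
  by apply: H; exists t; split; [left|rewrite -Et].
apply: H; exists (tcat a x); split=> //; right; rewrite lpart_tcat rpart_tcat.
split=> //; split=> // ex; apply: no; apply/new; rewrite ?lpart_tcat ?rpart_tcat //.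
Qed.

(** Each extension lowers the dimension of the uncovered set, so the process stops, and dimension
    [None] means that nothing is left. *)
Lemma section_exists : exists T, partial_section T /\ forall g, G g ->
  exists z, T z /\ g = pair_prod z.
Proof.
have ind d T : partial_section T -> dlt (dim (uncovered T)) d ->
    exists T, partial_section T /\ forall g, G g -> exists z, T z /\ g = pair_prod z.
  elim: d T => [|d IH] T sT small; case Ed: (dim (uncovered T)) small => [x|] //= ltx.
  - exists T; split=> // g Gg; apply: NNPP => no.
    by have /(dim_empty Hdim (definable_uncovered sT))/(_ g) := Ed; apply.
  - have [T' [sT' small]] := extend_section sT Ed; apply: (IH T') => //.
    by case: (dim _) small => //= y lty; apply: leq_trans lty _.
  - exists T; split=> // g Gg; apply: NNPP => no.
    by have /(dim_empty Hdim (definable_uncovered sT))/(_ g) := Ed; apply.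
have s0 : partial_section (fun _ => False).
  split=> //.
  apply: (@definable_ext _ _ _ _ (fun z : 'I_(m + m) -> M => ~ z = z)) => //.
  by apply: edef_definable; edef c0.
(* The empty section leaves all of [G] uncovered, of dimension [k], hence the strict bound
   [k.+1]. *)
apply: (ind k.+1 _ s0); apply: (dim_subset Hdim (definable_uncovered s0) dG).
  by move=> g [].
by rewrite HdimG /=.
Qed.

(** On a section covering [G], [pair_prod] is a bijection onto [G] with inverse [q], and the group
    law is transported along it. *)
Theorem iso_to_L_definable_chunk : iso_to_L_definable SM SE G mul.
Proof.
have [T [[dT Tg Tinj] cov]] := section_exists.
have one_G : G one by case: gG.
have /fun_choice [q Hq] : forall g, exists z, G g -> T z /\ g = pair_prod z.
  by move=> g; case: (classic (G g)) => [/cov [z Hz]|]; [exists z|exists (fun _ => c0)].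
have qT g : G g -> T (q g) by move=> /Hq [].
have qK g : G g -> pair_prod (q g) = g by move=> /Hq [].
have pG z : T z -> G (pair_prod z).
  by move=> /Tg [[Xl _] [Xr _]]; apply: group_closed; apply: chunk_mem.
have pK z : T z -> q (pair_prod z) = z.
  by move=> Tz; apply: Tinj => //; [apply: qT|apply: qK]; apply: pG.
pose hmul z w := q (mul (pair_prod z) (pair_prod w)).
have pmG z w : T z -> T w -> G (mul (pair_prod z) (pair_prod w)).
  by move=> Tz Tw; apply: group_closed; apply: pG.
exists (m + m), T, hmul, (q one); split.
  split=> //; split.
    (* The graph of [hmul] compares a product of two good points with a product of four, which
       [same_prod] does within [L]. *)
    apply: (@definable_ext _ _ _ _ (fun z => T (lpart (lpart z)) /\ T (rpart (lpart z)) /\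
      T (rpart z) /\ same_prod [:: rpart (rpart z); lpart (rpart z)]
        [:: rpart (rpart (lpart z)); lpart (rpart (lpart z));
            rpart (lpart (lpart z)); lpart (lpart (lpart z))])).
      move=> z; rewrite /op_graph.
      move: (lpart (lpart z)) (rpart (lpart z)) (rpart z) => a b c.
      have E : T a -> T b -> T c -> same_prod [:: rpart c; lpart c]
          [:: rpart b; lpart b; rpart a; lpart a] <->
          pair_prod c = mul (pair_prod a) (pair_prod b).
        move=> Ta Tb Tc; have [la ra] := Tg _ Ta; have [lb rb] := Tg _ Tb.
        have [lc rc] := Tg _ Tc; have [Xa _] := la; have [Xc _] := lc.
        have -> : mul (pair_prod a) (pair_prod b) =
            hprod [:: rpart b; lpart b; rpart a; lpart a].
          rewrite -(hprod_pair Xa) /= [in RHS]group_assoc //; last first.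
          + by apply: chunk_mem; case: rb.
          + by apply: chunk_mem; case: lb.
          by apply: (@hprod_mem [:: rpart a; lpart a]).
        by rewrite -(hprod_pair Xc); apply: same_prodP.
      split=> [[Ta [Tb [Tc /(E Ta Tb Tc) Ec]]]|[Ta [Tb Ec]]].
        by split=> //; split=> //; rewrite /hmul -Ec pK.
      have Tc : T c by rewrite Ec; apply: qT; apply: pmG.
      do 3!split=> //; apply: (proj2 (E Ta Tb Tc)); rewrite Ec qK //; exact: pmG.
    apply: edef_definable; do 3!(apply: edef_and; first by edef c0).
    pose c e := rpart (fun i : 'I_(m + m + (m + m) + (m + m)) => e (nat_of_ord i) : M).
    pose ab e := lpart (fun i : 'I_(m + m + (m + m) + (m + m)) => e (nat_of_ord i) : M).
    have /= := @edef_same_prod [:: fun e => rpart (c e); fun e => lpart (c e)]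
      [:: fun e => rpart (rpart (ab e)); fun e => lpart (rpart (ab e));
          fun e => rpart (lpart (ab e)); fun e => lpart (lpart (ab e))].
    by apply; rewrite /c /ab; repeat (split; [tterm|]).
  split; first exact: qT.
  split; first by move=> x y Tx Ty; apply: qT; apply: pmG.
  split.
    move=> x y z Tx Ty Tz; rewrite /hmul (qK _ (pmG _ _ Tx Ty)) (qK _ (pmG _ _ Ty Tz)).
    by rewrite (group_assoc (pG _ Tx) (pG _ Ty) (pG _ Tz)).
  split.
    move=> x Tx; rewrite /hmul qK //.
    by case: gG => _ [_ [_ [H _]]]; have [-> ->] := H _ (pG _ Tx); rewrite pK.
  move=> x Tx; case: gG => _ [_ [_ [_ H]]]; have [y [Gy [E1 E2]]] := H _ (pG _ Tx).
  by exists (q y); split; [apply: qT|rewrite /hmul qK // E1 E2].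
exists q; split; [split=> //|split].
- have dTN : defN T := definable_expand _ dT.
  (* The graph of [q] is the graph of [pair_prod] on [T] read backwards. *)
  apply: (@definable_ext _ _ _ _ (fun z => G (lpart z) /\ (T (rpart z) /\
    (sqset X (rpart z) /\ lpart z = pair_prod (rpart z))))).
    move=> z; split=> [[Gz [Tz [_ E]]]|[Gz ->]]; first by split=> //; rewrite E pK.
    have Tq := qT _ Gz; split=> //; split=> //; rewrite qK //; split=> //.
    by have [[? _] [? _]] := Tg _ Tq.
  apply: edef_definable; do 2!(apply: edef_and; first by edef c0).
  by apply: edef_pair_prod; tterm.
- split=> //; split; first by move=> x y Gx Gy E; rewrite -(qK x) // E qK.
  by move=> z Tz; exists (pair_prod z); split; [apply: pG|apply: pK].
- by move=> x y Gx Gy; rewrite /hmul !qK.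
Qed.

End GroupChunk.

(** * Definable groups as quotients by equality *)

(** Classes of equality are singletons, so [mk] and [rep] are inverse bijections between [H] and the
    quotient, and all data are carried along them. *)
Lemma iso_to_L_interpretable_of_definable (L Ex : signature) (M : Type) (SM : structure L M)
    (SE : structure Ex M) (c0 : M) n (G : ('I_n -> M) -> Prop) mul :
  iso_to_L_definable SM SE G mul -> iso_to_L_interpretable SM SE G mul.
Proof.
move=> [p [H [hmul [hone [[dH [dop gH]] [psi [dpsi [[psiH [psi_inj psi_surj]] psiM]]]]]]]].
pose Eq (z : 'I_(p + p) -> M) := H (lpart z) /\ lpart z = rpart z.
have EqE y z : Eq (tcat y z) <-> H y /\ y = z by rewrite /Eq lpart_tcat rpart_tcat.
have cls_inj y z : H y -> cls H Eq y = cls H Eq z -> y = z.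
  move=> Hy E; have : cls H Eq y y by split=> //; apply/EqE.
  by rewrite E => -[_ /EqE [_ ->]].
have [H1 [Hmul [HA [Hid Hinv]]]] := gH.
have /fun_choice [mk Hmk] : forall y, exists Q : quot H Eq, H y -> proj1_sig Q = cls H Eq y.
  move=> y; case: (classic (H y)) => Hy.
    by exists (exist _ (cls H Eq y) (ex_intro _ y (conj Hy erefl))).
  (* Off [H], the class of the identity is the default value. *)
  by exists (exist _ (cls H Eq hone) (ex_intro _ hone (conj H1 erefl))).
have /fun_choice [rep Hrep] : forall Q : quot H Eq, exists y, H y /\ proj1_sig Q = cls H Eq y.
  by move=> [C [y HC]]; exists y.
have repH Q : H (rep Q) by have [] := Hrep Q.
have quot_eq (Q Q' : quot H Eq) : proj1_sig Q = proj1_sig Q' -> Q = Q'.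
  case: Q Q' => [C HC] [C' HC'] /= E; subst C'; congr exist; exact: proof_irrelevance.
have repK Q : mk (rep Q) = Q by apply: quot_eq; rewrite Hmk //; have [_ ->] := Hrep Q.
have mkK y : H y -> rep (mk y) = y.
  by move=> Hy; apply: cls_inj => //; have [_ <-] := Hrep (mk y); rewrite Hmk.
have repE Q y : H y -> proj1_sig Q = cls H Eq y <-> rep Q = y.
  move=> Hy; split=> [E|<-]; last by have [] := Hrep Q.
  by apply: cls_inj => //; have [_ <-] := Hrep Q.
exists p, H, Eq; split=> //; split; first by apply: edef_definable; rewrite /Eq; edef c0.
split.
  split; first by move=> y z /EqE [Hy <-].
  split; first by move=> y Hy; apply/EqE.
  split; first by move=> y z /EqE [Hy <-]; apply/EqE.
  by move=> x y z /EqE [Hx <-] /EqE [_ <-]; apply/EqE.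
exists (fun A B => mk (hmul (rep A) (rep B))), (mk hone); split.
  split=> //; split=> //; split.
    by move=> x y z _ _ _; rewrite !mkK ?HA //; apply: Hmul.
  split=> x _; first by rewrite !mkK //; have [-> ->] := Hid _ (repH x); rewrite repK.
  have [y [Hy [E1 E2]]] := Hinv _ (repH x); exists (mk y).
  by rewrite !mkK // E1 E2.
split.
  apply: definable_ext (dop) => z; rewrite /op_graph /=.
  move: (lpart (lpart z)) (rpart (lpart z)) (rpart z) => a b c.
  split=> [[Ha [Hb ->]]|[Ha [Hb [Hc [A [B [/repE Ea [/repE Eb /repE Ec]]]]]]]].
    have Hc := Hmul _ _ Ha Hb; do 3!split=> //.
    by exists (mk a), (mk b); rewrite !mkK // !Hmk.
  do 2!split=> //; rewrite -(Ea Ha) -(Eb Hb) -(Ec Hc) mkK //; exact: Hmul.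
exists (fun x => mk (psi x)); split.
  move=> x x' Gx Gx' E; apply: psi_inj => //; rewrite -[psi x]mkK ?E ?mkK //; exact: psiH.
split.
  move=> Q; have [x [Gx E]] := psi_surj _ (repH Q); exists x; split=> //.
  by rewrite E repK.
split; first by move=> x y Gx Gy; rewrite psiM // !mkK //; apply: psiH.
have [_] := dpsi; apply: definable_ext => z; split=> [[Gz ->]|[Gz [Hz /(repE _ _ Hz) E]]].
  by split=> //; split; [apply: psiH|rewrite Hmk //; apply: psiH].
by split=> //; rewrite -E mkK //; apply: psiH.
Qed.

Theorem theorem4p4
  (L Ex : signature) (M : Type) (SM : structure L M) (SE : structure Ex M)
  (dim : dimfun M) (Hdim : dim_axioms SM SE dim)
  (n : nat) (G : ('I_n -> M) -> Prop)
  (mul : ('I_n -> M) -> ('I_n -> M) -> ('I_n -> M)) (one : 'I_n -> M)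
  (HG : definable_group (expand SM SE) G mul one)
  (k : nat) (HdimG : dim n G = Some k)
  (m : nat) (X : ('I_m -> M) -> Prop) (Z : ('I_(m + m) -> M) -> Prop)
  (* (i) *)
  (HX : definable SM X) (HZ : definable SM Z)
  (HZX : forall z, Z z -> sqset X z)
  (HXZ : dlt (dim (m + m) (fun z => sqset X z /\ ~ Z z)) (2 * k))
  (* (ii) *)
  (h : ('I_m -> M) -> ('I_n -> M))
  (Hh : def_map (expand SM SE) X G h)
  (Hhinj : forall x x', X x -> X x' -> h x = h x' -> x = x')
  (HhX : dlt (dim n (fun g => G g /\ ~ (exists x, X x /\ h x = g))) k)
  (* (iii) *)
  (F : ('I_(m + m) -> M) -> ('I_m -> M))
  (HF : def_map SM (sqset X) X F)
  (HFZ : forall z, Z z -> mul (h (lpart z)) (h (rpart z)) = h (F z)) :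
  iso_to_L_interpretable SM SE G mul /\
  (o_minimal SM -> iso_to_L_definable SM SE G mul).
Proof.
(* A parameter assignment from the definition of [X] provides the default element [par 0] of [M]. *)
have [_ [par _]] := HX; have [dG [dmul gG]] := HG.
have iso := iso_to_L_definable_chunk Hdim (par 0) dG dmul gG HdimG HX HZ HZX HXZ Hh Hhinj
  HhX HF HFZ.
by split=> //; exact (iso_to_L_interpretable_of_definable (par 0) iso).
Qed.
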